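(* If the closure operator $\mathrm{cl}$ is finitary, then a finitary and finitely consistent SDS $K\subseteq\mathcal P(\mathcal T)$ is finitely coherent if and only if $K=\bigcap\{K_D:D\in\overline{\mathbf D}\text{ and }K\subseteq K_D\}$.
   Context: Let $\mathcal T$ be a non-empty set (of ''things''). Let $\mathrm{cl}:\mathcal P(\mathcal T)\to\mathcal P(\mathcal T)$ be a closure operator (extensive, monotone, idempotent); it is finitary if $\mathrm{cl}(A)=\bigcup\{\mathrm{cl}(F):F\subseteq A,\ F\text{ finite}\}$ for all $A\subseteq\mathcal T$ (the empty set counts as finite). Let $\mathcal T_-\subseteq\mathcal T$ be a set of forbidden things and $\mathcal T_+:=\mathrm{cl}(\emptyset)$, with standing assumption $\mathcal T_+\cap\mathcal T_-=\emptyset$. A coherent SDT is a $D\subseteq\mathcal T$ with $\mathrm{cl}(D)=D$ and $D\cap\mathcal T_-=\emptyset$; $\overline{\mathbf D}$ is the set of all coherent SDTs. For $D\subseteq\mathcal T$ let $K_D:=\{S\subseteq\mathcal T:S\cap D\neq\emptyset\}$. For $\mathcal W\subseteq\mathcal P(\mathcal T)$, $\Sigma_{\mathcal W}$ is the set of maps $\sigma:\mathcal W\to\mathcal T$ with $\sigma(S)\in S$ for all $S\in\mathcal W$, and $\sigma(\mathcal W):=\{\sigma(S):S\in\mathcal W\}$. An SDS is any $K\subseteq\mathcal P(\mathcal T)$. It is finitely coherent if (K1) $\emptyset\notin K$; (K2) if $S_1\in K$ and $S_1\subseteq S_2\subseteq\mathcal T$ then $S_2\in K$; (K3) if $S\in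 K$ then $S\setminus\mathcal T_-\in K$; (K4) $\{t\}\in K$ for all $t\in\mathcal T_+$; (K5fin) for every non-empty finite $\mathcal W\subseteq K$ and every family $(t_\sigma)_{\sigma\in\Sigma_{\mathcal W}}$ with $t_\sigma\in\mathrm{cl}(\sigma(\mathcal W))$, $\{t_\sigma:\sigma\in\Sigma_{\mathcal W}\}\in K$. An SDS is finitely consistent if it is included in some finitely coherent SDS. An SDS $K$ is finitary if every $S\in K$ has a finite subset $A\subseteq S$ with $A\in K$. *)

(* Defs.v *)
From mathcomp Require Import all_boot.
From mathcomp Require Import all_classical.

Set Implicit Arguments.
Unset Strict Implicit.
Unset Printing Implicit Defensive.

Local Open Scope classical_set_scope.

Section SetsOfDesirableThings.
Variable T : Type.
Implicit Types (cl : set T -> set T) (Tminus D : set T) (K W : set (set T)).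

Record closure_operator cl : Prop := ClosureOperator {
  cl_extensive : forall A, A `<=` cl A;
  cl_monotone : forall A B, A `<=` B -> cl A `<=` cl B;
  cl_idempotent : forall A, cl (cl A) = cl A }.

Definition finitary_closure cl : Prop :=
  forall A, cl A = \bigcup_(F in [set F | F `<=` A /\ finite_set F]) cl F.

Definition Tplus cl : set T := cl set0.

Definition coherent_SDT cl Tminus : set (set T) :=
  [set D | cl D = D /\ D `&` Tminus = set0].

Definition SDS_of D : set (set T) := [set S | S `&` D !=set0].

(* The domain of a selection is the subtype W of set T, not the whole of
   set T, so that two selections are equal when they agree on W. *)
Definition selections W : set (W -> T) :=
  [set sigma | forall S : W, val S (sigma S)].
Arguments selections : clear implicits.

(* In K5fin, t is a total function of which only the values at the selections
   of W are constrained and used; as T is non-empty, this ranges over exactly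
   the families indexed by [selections W]. *)
Record finitely_coherent cl Tminus K : Prop := FinitelyCoherent {
  coherentK1 : ~ K set0;
  coherentK2 : forall S1 S2, K S1 -> S1 `<=` S2 -> K S2;
  coherentK3 : forall S, K S -> K (S `\` Tminus);
  coherentK4 : forall t, Tplus cl t -> K [set t];
  coherentK5fin : forall W, W !=set0 -> finite_set W -> W `<=` K ->
    forall t : (W -> T) -> T,
      (forall sigma, selections W sigma -> cl (range sigma) (t sigma)) ->
      K (t @` selections W) }.

Definition finitely_consistent cl Tminus K : Prop :=
  exists2 K', finitely_coherent cl Tminus K' & K `<=` K'.

Definition finitary_SDS K : Prop :=
  forall S, K S -> exists A, [/\ A `<=` S, finite_set A & K A].

End SetsOfDesirableThings.

(* Main.v *)
Require Import Defs.
From mathcomp Require Import all_boot.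
From mathcomp Require Import all_classical.

(** To separate a set [S] outside [K] from [K], enlarge [S] by Zorn's lemma to a
    maximal set [N] outside [K]; chains have upper bounds because [K] is
    finitary. The separating coherent [D] is the complement of [N]: if [D] were
    not closed, finitarity of [cl] would give a finite [F `<=` D] and [t] in both
    [N] and [cl F]. Each [N] enlarged by one [f] in [F] lies in [K] by maximality,
    and every selection from these sets either meets [N] or exhausts [F], so that
    K5 produces a subset of [N] that belongs to [K], a contradiction. *)

Local Open Scope classical_set_scope.

(** Induction on [A]: of a member containing the tail and one containing the new element, the larger
    contains both. *)
Lemma finite_subset_chain {T : Type} {F : set (set T)} {A : set T} :
  F !=set0 -> total_on F subset -> finite_set A -> A `<=` \bigcup_(X in F) X ->
  exists2 X, F X & A `<=` X.
Proof.
move=> [X0 FX0] totF /(@finite_seqP {classic T})[s ->].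
elim: s => [|a s IHs] sF; first by exists X0.
have [X FX sX] : exists2 X, F X & [set` s] `<=` X.
  by apply: IHs => x /= xs; apply: sF; rewrite /= inE xs orbT.
have [Y FY aY] : (\bigcup_(X in F) X) a by apply: sF; rewrite /= mem_head.
have [XY|YX] := totF _ _ FX FY; [exists Y|exists X] => // x /=;
  rewrite inE => /orP[/eqP->|/sX Xx] //.
  exact: XY.
exact: YX.
Qed.

Lemma SDS_of_finitely_coherent {T : Type} {cl : set T -> set T}
    {Tminus D : set T} :
  closure_operator cl -> coherent_SDT cl Tminus D ->
  finitely_coherent cl Tminus (SDS_of D).
Proof.
move=> [_ cl_mono _] [clD DT]; split.
- by move=> [x []].
- by move=> S1 S2 [x [S1x Dx]] S12; exists x; split=> //; exact: S12.
- move=> S [x [Sx Dx]]; exists x; split=> //; split=> // Tx.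
  by have : set0 x by rewrite -DT.
- by move=> t tT; exists t; split=> //; rewrite -clD; exact: cl_mono tT.
- move=> W _ _ WD t tcl.
  (* Each set in [W] meets [D], so some selection has its range in [D]; its [t sigma] lies in
     [cl D], which is [D]. *)
  have [sigma sigmaP] :
      {sigma : W -> T & forall S, val S (sigma S) /\ D (sigma S)}.
    by apply: (@choice _ _ (fun (S : W) x => val S x /\ D x)) => S;
      exact: (WD _ (set_valP S)).
  exists (t sigma); split; first by exists sigma => // S; case: (sigmaP S).
  rewrite -clD; apply: (cl_mono (range sigma)).
    by move=> _ [S _ <-]; case: (sigmaP S).
  by apply: tcl => S; case: (sigmaP S).
Qed.

(** K2 to K5 pass to any intersection; K1 needs [P] non-empty, as the empty intersection contains
    [set0]. *)
Lemma bigcap_finitely_coherent {T I : Type} {cl : set T -> set T}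
    {Tminus : set T} {P : set I} {G : I -> set (set T)} :
  P !=set0 -> (forall i, P i -> finitely_coherent cl Tminus (G i)) ->
  finitely_coherent cl Tminus (\bigcap_(i in P) G i).
Proof.
move=> [i0 Pi0] Gcoh; split.
- by move=> /(_ _ Pi0); exact: coherentK1 (Gcoh _ Pi0).
- by move=> S1 S2 S1G S12 i Pi; exact: coherentK2 (Gcoh _ Pi) _ _ (S1G _ Pi) S12.
- by move=> S SG i Pi; exact: coherentK3 (Gcoh _ Pi) _ (SG _ Pi).
- by move=> t tT i Pi; exact: coherentK4 (Gcoh _ Pi) _ tT.
- move=> W W0 Wfin WG t tcl i Pi.
  by apply: (coherentK5fin (Gcoh _ Pi)) => // S /WG; apply.
Qed.

Lemma maximal_nonmember {T : Type} {K : set (set T)} {S : set T} :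
  (forall S1 S2, K S1 -> S1 `<=` S2 -> K S2) -> finitary_SDS K -> ~ K S ->
  exists N, [/\ S `<=` N, ~ K N & forall B, N `<` B -> K B].
Proof.
move=> Kup Kfin nKS.
(* Zorn runs over the part [X] joined to [S], so that the empty chain only asks for [~ K S]. *)
have [F FP totF|N [nKN maxN]] := @Zorn_bigcup T [set X | ~ K (S `|` X)].
  have [->|F0] := eqVneq F set0; first by rewrite /= bigcup_set0 setU0.
  move=> /Kfin[A [ASF Afin KA]].
  have [X FX ADX] : exists2 X, F X & A `\` S `<=` X.
    apply: finite_subset_chain => //; first exact/set0P.
      exact: finite_setD.
    by move=> x [/ASF[]].
  apply: (FP _ FX); apply: Kup KA _ => x Ax.
  by have [Sx|nSx] := pselect (S x); [left|right; apply: ADX].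
exists (S `|` N); split=> //.
move=> B [NSB BNS]; apply: contrapT => nKB; apply: (maxN B).
  split=> [|BN]; first by move=> x Nx; apply: NSB; right.
  by apply: BNS => x /BN Nx; right.
by rewrite /= setUidr // => x Sx; apply: NSB; left.
Qed.

Lemma coherent_setC_maximal {T : Type} {cl : set T -> set T}
    {Tminus : set T} {K : set (set T)} {N : set T} :
  closure_operator cl -> finitary_closure cl -> finitely_coherent cl Tminus K ->
  ~ K N -> (forall B, N `<` B -> K B) -> coherent_SDT cl Tminus (~` N).
Proof.
move=> [cl_ext cl_mono _] cl_fin [_ Kup KT KTplus K5] nKN maxN.
have KU1 f : ~ N f -> K (f |` N).
  move=> nNf; apply: maxN; split=> [x Nx|fN]; first by right.
  by apply: nNf; apply: fN; left.
split; last first.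
  (* K3 removes the forbidden [x] from [N] enlarged by [x], which leaves a subset of [N] in [K]. *)
  rewrite -subset0 => x [nNx Tx]; apply: nKN.
  apply: Kup (KT _ (KU1 _ nNx)) _ => y [[->|//] nTy].
  by case: nTy.
apply/seteqP; split; last exact: cl_ext.
move=> t; rewrite cl_fin => -[F [FN Ffin] tF] Nt.
(* K5 needs a non-empty [W]. For empty [F], [t] is in [Tplus cl], and K4 already puts a subset of
   [N] in [K]. *)
have [F0|/set0P[f0 Ff0]] := eqVneq F set0.
  by apply: nKN; apply: Kup (KTplus t _) _ => [|_ ->//]; rewrite /Tplus -F0.
pose W := [set f |` N | f in F].
(* Take a value of [sigma] in [N] if there is one. Otherwise a selection picks each [f] from its own
   set, its range contains [F], and [t] serves. *)
have pickP (sigma : W -> T) : exists u, @selections T W sigma ->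
    cl (range sigma) u /\ N u.
  have [[S NS]|nN] := pselect (exists S, N (sigma S)).
    by exists (sigma S) => _; split=> //; apply: cl_ext; exists S.
  exists t => sigmaP; split=> //; apply: cl_mono tF => f Ff.
  have Wf : W (f |` N) by exists f.
  pose S : W := SigSub (mem_set Wf).
  by exists S => //; case: (sigmaP S) => // NS; case: nN; exists S.
have [u uP] := choice pickP.
apply: nKN; apply: (Kup (u @` @selections T W)).
  apply: K5; [by exists (f0 |` N), f0|exact: finite_image| |].
    by move=> _ [f Ff <-]; apply: KU1; exact: FN.
  by move=> sigma /uP[].
by move=> _ [sigma /uP[_ ?] <-].
Qed.

Theorem theorem10 (T : Type) (cl : set T -> set T) (Tminus : set T)
    (K : set (set T)) :
  inhabited T ->
  closure_operator cl ->
  Tplus cl `&` Tminus = set0 ->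
  finitary_closure cl ->
  finitary_SDS K ->
  finitely_consistent cl Tminus K ->
  (finitely_coherent cl Tminus K <->
   K = \bigcap_(D in [set D | coherent_SDT cl Tminus D /\ K `<=` SDS_of D])
         SDS_of D).
Proof.
move=> _ clP _ cl_fin Kfin [K' K'coh KK']; split=> [Kcoh|KE].
  apply/seteqP; split=> [S KS D [_]|S SD]; first exact.
  apply: contrapT => nKS.
  have [N [SN nKN maxN]] := maximal_nonmember (coherentK2 Kcoh) Kfin nKS.
  have [|x [/SN Nx]] := SD (~` N); last exact.
  split; first exact: coherent_setC_maximal clP cl_fin Kcoh nKN maxN.
  (* A member of [K] missing the complement of [N] would lie inside [N]. *)
  move=> A KA; apply: contrapT => AN; apply: nKN.
  apply: (coherentK2 Kcoh) KA _ => x Ax.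
  by apply: contrapT => nNx; apply: AN; exists x.
rewrite KE; apply: bigcap_finitely_coherent.
  (* Without any such [D] the intersection is everything, so [set0] would be in [K] and hence in
     [K'], against K1. *)
  apply: contrapT => noD; apply: (coherentK1 K'coh); apply: KK'.
  by rewrite KE => D DP; case: noD; exists D.
by move=> D [Dcoh _]; exact: SDS_of_finitely_coherent.
Qed.
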